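(* Let $\mathbb{L}(x,y;z)=\sum_{n\ge 1}L_n(x,y)\,z^{n-1}$. Then $$\mathbb{L}(x,y;z)=\frac{1-xy}{(1-x)(1-y)}\cdot\frac{C(x,xz)+C(y,yz)-C(x,xz)\,C(y,yz)}{1-z\,C(x,xz)\,C(y,yz)},$$ where $C(q,z)=\sum_{n\ge 0}\sum_{w}q^{\mathrm{area}(w)}z^n$, the inner sum being over all Dyck words $w$ of semi-length $n$.
   Context: Words are over $\{a,b\}$; $|u|_a,|u|_b$ are letter counts and $\delta(u)=|u|_a-|u|_b$. A Dyck word is a word $w$ with $|w|_a=|w|_b$ and $\delta(u)\ge 0$ for every prefix $u$; its semi-length is $|w|_a$. Its heights are $\eta_i=\delta(w^{(i)})$, where $w^{(i)}$ is the prefix immediately preceding the $i$-th occurrence of $a$, and $\mathrm{area}(w)=\sum_i\eta_i$ (the empty word has area $0$). $D_n$ is the set of words with $n-1$ letters $a$ and $n$ letters $b$ such that $\delta(u)\ge0$ for every strict prefix $u$; equivalently, $D_n=\{w'b: w' \text{ a Dyck word of semi-length } n-1\}$. Labelled strip, for $n\ge 2$: consider the strip $0\le y\le n-1$ of the plane cut into $n-1$ infinite rows of unit cells. The cell $[x-1,x]\times[y,y+1]$ ($x\in\mathbb{Z}$, $0\le y\le n-2$) has label $ny-(n-1)x$; each integer labels exactly one cell. A word $w\in D_n$ is drawn as a lattice path starting at the origin, with a north unit step for each $a$ and an east unit step for each $b$. It has exactly one north step in each row; the cells of that row to the west of this step form the left region, those to the east form the right region. For $s\in\mathbb{Z}$,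 $\mathrm{left}(w,s)$ is the number of cells in the left region with label $\le s$, and $\mathrm{right}(w,s)$ is the number of cells in the right region with label $>s$. For $n\ge 2$, $$L_n(x,y)=\sum_{w\in D_n}\sum_{s=-\infty}^{+\infty}x^{\mathrm{left}(w,s)}y^{\mathrm{right}(w,s)},$$ a formal power series in $x,y$; and by convention $L_1(x,y)=\frac{x}{1-x}+\frac{1}{1-y}=\frac{1-xy}{(1-x)(1-y)}$. (For $n\ge2$ this encodes the joint distribution of degree and rank on sorted parking configurations of the complete graph $K_n$.) *)

(* Defs.v *)
From HB Require Import structures.
From mathcomp Require Import all_boot all_order all_algebra.
From mathcomp Require Import finmap.
From mathcomp Require Import boolp classical_sets functions cardinality fsbigop.

Set Implicit Arguments.
Unset Strict Implicit.
Unset Printing Implicit Defensive.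

Import GRing.Theory.
Local Open Scope ring_scope.

(* [fps R] is R[[t]]; iterating the construction, Z[[x]][[y]][[z]] is          *)
(* [fps (fps (fps int))], in which x is the innermost variable.                *)
Record fps (R : Type) := Fps { coefs :> nat -> R }.

Lemma fpsP (R : Type) (f g : fps R) : f =1 g -> f = g.
Proof. by case: f g => [f] [g] /= /funext ->. Qed.

HB.instance Definition _ (R : Type) := gen_eqMixin (fps R).
HB.instance Definition _ (R : Type) := gen_choiceMixin (fps R).

Section Zmodule.
Variable R : zmodType.
Implicit Types f g h : fps R.

Definition fps_zero : fps R := Fps (fun=> 0).
Definition fps_opp f : fps R := Fps (fun n => - f n).
Definition fps_add f g : fps R := Fps (fun n => f n + g n).

Let addA : associative fps_add.
Proof. by move=> f g h; apply: fpsP => n /=; rewrite addrA. Qed.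
Let addC : commutative fps_add.
Proof. by move=> f g; apply: fpsP => n /=; rewrite addrC. Qed.
Let add0 : left_id fps_zero fps_add.
Proof. by move=> f; apply: fpsP => n /=; rewrite add0r. Qed.
Let addN : left_inverse fps_zero fps_opp fps_add.
Proof. by move=> f; apply: fpsP => n /=; rewrite addNr. Qed.

HB.instance Definition _ := GRing.isZmodule.Build (fps R) addA addC add0 addN.

Lemma coefs0 n : (0 : fps R) n = 0. Proof. by []. Qed.
Lemma coefsD f g n : (f + g) n = f n + g n. Proof. by []. Qed.
Lemma coefsN f n : (- f) n = - f n. Proof. by []. Qed.
Lemma coefsB f g n : (f - g) n = f n - g n. Proof. by []. Qed.

Lemma coefs_sum (I : Type) (r : seq I) (P : pred I) (F : I -> fps R) n :
  (\sum_(i <- r | P i) F i) n = \sum_(i <- r | P i) F i n.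
Proof. by elim/big_rec2: _ => // i a b _ <-. Qed.
End Zmodule.

Section Ring.
Variable R : comNzRingType.
Implicit Types f g h : fps R.

Definition fpsC (c : R) : fps R := Fps (fun n => if n == 0%N then c else 0).
Definition fpsX : fps R := Fps (fun n => (n == 1%N)%:R).
Definition fps_mul f g : fps R := Fps (fun n => \sum_(i < n.+1) f i * g (n - i)%N).

Let trunc m f : {poly R} := \poly_(i < m.+1) f i.

Let mulE m f g n : (n <= m)%N -> fps_mul f g n = (trunc m f * trunc m g)`_n.
Proof.
move=> le_nm; rewrite coefM; apply: eq_bigr => i _; rewrite !coef_poly.
have le_in : (i <= n)%N by rewrite -ltnS.
by rewrite !ltnS (leq_trans le_in le_nm) (leq_trans (leq_subr _ _) le_nm).
Qed.

Let mulC : commutative fps_mul.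
Proof. by move=> f g; apply: fpsP => n; rewrite !(mulE _ _ (leqnn n)) mulrC. Qed.

Let mulA : associative fps_mul.
Proof.
have mulAE f g h n :
    fps_mul (fps_mul f g) h n = (trunc n f * trunc n g * trunc n h)`_n.
  rewrite coefM; apply: eq_bigr => i _; have le_in : (i <= n)%N by rewrite -ltnS.
  by rewrite (@mulE n) // coef_poly ltnS leq_subr.
by move=> f g h; apply: fpsP => n; rewrite mulC !mulAE mulrC mulrA.
Qed.

Let mul1 : left_id (fpsC 1) fps_mul.
Proof.
move=> f; apply: fpsP => n /=; rewrite big_ord_recl /= mul1r subn0.
by rewrite big1 ?addr0 // => i _; rewrite mul0r.
Qed.

Let mulDl : left_distributive fps_mul (@fps_add R).
Proof.
move=> f g h; apply: fpsP => n /=; rewrite -big_split /=.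
by apply: eq_bigr => i _; rewrite mulrDl.
Qed.

Let one_neq0 : fpsC 1 != 0.
Proof. by apply/eqP => /(congr1 (fun f : fps R => f 0%N))/eqP; rewrite oner_eq0. Qed.

HB.instance Definition _ :=
  GRing.Zmodule_isComNzRing.Build (fps R) mulA mulC mul1 mulDl one_neq0.

Lemma coefs1 n : (1 : fps R) n = (n == 0%N)%:R.
Proof. by case: n. Qed.
Lemma coefsM f g n : (f * g) n = \sum_(i < n.+1) f i * g (n - i)%N.
Proof. by []. Qed.
Lemma coefsM0 f g : (f * g) 0%N = f 0%N * g 0%N.
Proof. by rewrite coefsM big_ord1. Qed.

Lemma coefsX_small f k n : f 0%N = 0 -> (n < k)%N -> (f ^+ k) n = 0.
Proof.
move=> f0; elim: k n => // k IHk n; rewrite ltnS exprS coefsM => le_nk.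
rewrite big_ord_recl /= f0 mul0r add0r big1 // => i _.
have lt_n : (n - lift ord0 i < n)%N.
  by rewrite ltn_subrL; case: n {le_nk} i => [[]|].
by rewrite IHk ?mulr0 // (leq_trans lt_n).
Qed.

(* Substitution f(g) for g without constant term: then [(g ^+ k) n] vanishes   *)
(* for k > n, so the sum below is the n-th coefficient of sum_k f_k g^k.       *)
Definition fps_comp f g : fps R :=
  Fps (fun n => \sum_(k < n.+1) f k * (g ^+ k) n).
End Ring.

Arguments fpsX {R}.

Section UnitRing.
Variable R : comUnitRingType.
Implicit Types f g h : fps R.

Definition fps_unit : pred (fps R) := fun f => f 0%N \is a GRing.unit.

(* With f = f_0 (1 - h) and h without constant term, f^-1 = f_0^-1 sum_k h^k.  *)
Definition fps_inv f : fps R :=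
  if fps_unit f
  then fpsC (f 0%N)^-1 * fps_comp (Fps (fun=> 1)) (1 - fpsC (f 0%N)^-1 * f)
  else f.

Let mul_geom h : h 0%N = 0 -> fps_comp (Fps (fun=> 1)) h * (1 - h) = 1.
Proof.
move=> h0; apply: fpsP => n.
transitivity (((\sum_(k < n.+1) h ^+ k) * (1 - h)) n).
  rewrite !coefsM; apply: eq_bigr => i _; congr (_ * _).
  have le_in : (i < n.+1)%N by [].
  rewrite coefs_sum -(big_mkord xpredT (fun k => (h ^+ k) i)).
  rewrite (big_cat_nat (n := i.+1)) //= big_mkord.
  rewrite [X in _ = _ + X]big_nat_cond [X in _ = _ + X]big1 => [|k].
    by rewrite addr0; apply: eq_bigr => k _; rewrite mul1r.
  by rewrite andbT => /andP[lt_ik _]; apply: coefsX_small.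
rewrite mulrC -opprB mulNr -subrX1 opprB coefsB coefsX_small ?subr0 //.
Qed.

Let mulV : {in fps_unit, left_inverse 1 fps_inv *%R}.
Proof.
move=> f f_unit; rewrite /fps_inv ifT //.
set u := fpsC _; set h := 1 - u * f.
have h0 : h 0%N = 0 by rewrite coefsB coefsM0 /= mulVr // subrr.
by rewrite mulrAC mulrC -[X in _ * X](subKr 1) mul_geom.
Qed.

Let unitP f g : g * f = 1 -> fps_unit f.
Proof.
move=> /(congr1 (fun k : fps R => k 0%N)); rewrite coefsM0 coefs1 => gf1.
by apply/unitrPr; exists (g 0%N); rewrite mulrC.
Qed.

Let invN : {in [predC fps_unit], fps_inv =1 id}.
Proof. by move=> f /negPf f_unit; rewrite /fps_inv [fps_unit f]f_unit. Qed.

HB.instance Definition _ :=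
  GRing.ComNzRing_hasMulInverse.Build (fps R) mulV unitP invN.

Lemma fps_unitE f : (f \is a GRing.unit) = (f 0%N \is a GRing.unit).
Proof. by []. Qed.
End UnitRing.

(* Words are of type [seq bool], the letter a being [true] and b [false].      *)
Notation letter_a := true (only parsing).
Notation letter_b := false (only parsing).

Definition delta (u : seq bool) : int :=
  (count_mem letter_a u)%:Z - (count_mem letter_b u)%:Z.

Definition dyck (w : seq bool) : bool :=
  (count_mem letter_a w == count_mem letter_b w) &&
  all (fun i => 0 <= delta (take i w)) (iota 0 (size w).+1).

(* Words of semi-length n are encoded with their length n + n in the type.     *)
Definition dyck_words (n : nat) : {set (n + n).-tuple bool} :=
  [set w : (n + n).-tuple bool | dyck w & count_mem letter_a w == n]%SET.

(* The prefix of w immediately preceding the i-th occurrence of a (i from 0).  *)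
Definition prefix_before_a (w : seq bool) (i : nat) : seq bool :=
  take (nth 0%N [seq k <- iota 0 (size w) | nth letter_b w k == letter_a] i) w.

Definition height (w : seq bool) (i : nat) : int := delta (prefix_before_a w i).

Definition area (w : seq bool) : int := \sum_(i < count_mem letter_a w) height w i.

(* Only strict prefixes are constrained. *)
Definition Dset (n : nat) : {set (n.-1 + n).-tuple bool} :=
  [set w : (n.-1 + n).-tuple bool |
     [&& count_mem letter_a w == n.-1, count_mem letter_b w == n
       & all (fun i => 0 <= delta (take i w)) (iota 0 (size w))]]%SET.

(* The cell [x-1,x] x [y,y+1] is the pair (x, y). *)
Definition label (n : nat) (c : int * nat) : int :=
  n%:Z * c.2%:Z - (n%:Z - 1) * c.1.

(* The north step of the path of w in row y is the (y+1)-th occurrence of a;   *)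
(* its abscissa is the number of east steps before it.                         *)
Definition north_abscissa (w : seq bool) (y : nat) : int :=
  (count_mem letter_b (prefix_before_a w y))%:Z.

Local Open Scope classical_set_scope.

Definition left_region (n : nat) (w : seq bool) : set (int * nat) :=
  [set c | (c.2 < n.-1)%N /\ c.1 <= north_abscissa w c.2].

Definition right_region (n : nat) (w : seq bool) : set (int * nat) :=
  [set c | (c.2 < n.-1)%N /\ north_abscissa w c.2 <= c.1 - 1].

(* The sets of cells counted here are finite for n >= 2. *)
Definition left_count (n : nat) (w : seq bool) (s : int) : nat :=
  #|` fset_set (left_region n w `&` [set c | label n c <= s])|.

Definition right_count (n : nat) (w : seq bool) (s : int) : nat :=
  #|` fset_set (right_region n w `&` [set c | s < label n c])|.

(* Coefficientwise sum of a family of series in two variables, in each         *)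
(* bidegree of which only finitely many members are nonzero.                   *)
Definition fps2_sum (I : choiceType) (F : I -> fps (fps int)) : fps (fps int) :=
  Fps (fun j => Fps (fun i => \sum_(s \in [set: I]) F s j i)).

Section Series.
Let x : fps (fps int) := fpsC fpsX.
Let y : fps (fps int) := fpsX.

(* L_1 is given by convention. *)
Definition L (n : nat) : fps (fps int) :=
  if n == 1%N then x / (1 - x) + 1 / (1 - y)
  else \sum_(w in Dset n)
         fps2_sum (fun s : int => x ^+ left_count n w s * y ^+ right_count n w s).
End Series.

Definition LL : fps (fps (fps int)) := Fps (fun m => L m.+1).

(* C(q, t), as a series in t; heights in a Dyck word, hence its area, are      *)
(* nonnegative. *)
Definition Cseries (R : comNzRingType) (q : R) : fps R :=
  Fps (fun n => \sum_(w in dyck_words n) q ^+ `|area w|%N).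

(* C(q, f) for a series f without constant term. *)
Definition C (R : comNzRingType) (q : R) (f : fps R) : fps R :=
  fps_comp (Cseries q) f.

(* Main.v *)
Require Import Defs.
From mathcomp Require Import all_boot all_order all_algebra.
From mathcomp Require Import finmap.
From mathcomp Require Import classical_sets cardinality fsbigop.
From mathcomp Require Import ring zify.

(* Let m = n - 1.  Repeating a word w of D_n forever gives a path whose level
   drops by 1 in each period, and the cells of row y contribute the factor
   omega(v) to x^left y^right, where v is the level of the y-th letter a and
   omega(v) = y^v for v >= 0, x^(-v) for v < 0; running s through Z amounts to
   choosing the letter a at which the period starts and its level h.  By the
   cycle lemma, L_n is therefore the sum over h of E_a(h), the weight of the
   paths from h to h - 1 with m letters a that start with a.  Let B(h) be the
   weight of the paths from h to h with m letters a.  Splitting off the first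
   or the last letter of the paths from h + 1 to h yields
     E_a(h) = y (E_a(h+1) + B(h) - B(h+1))    if h >= 1,
     x E_a(h) = E_a(h+1) + B(h) - B(h+1)      if h <= 0,
   and summing over h telescopes to
     (1-x)(1-y) L_n = (1-xy) (B(1) - E_a(1)).
   The right-hand side counts paths between the levels 0 and 1, whose
   generating functions follow from the decomposition at the visits to these
   two levels: an excursion above 1 is counted by C(y,yz), one below 0 by
   C(x,xz). *)

Set Implicit Arguments.
Unset Strict Implicit.
Unset Printing Implicit Defensive.

Import Order.TTheory GRing.Theory Num.Theory.
Local Open Scope ring_scope.

(** * Weighted lattice paths *)

Section FpsTheory.
Variable R : comNzRingType.
Implicit Types f g : fps R.

Lemma coefsXM f n : (fpsX * f) n = if n is n'.+1 then f n' else 0.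
Proof.
rewrite coefsM; case: n => [|n]; first by rewrite big_ord1 /= mul0r.
rewrite 2!big_ord_recl /= mul0r add0r mul1r subSS subn0 big1 ?addr0 // => i _.
by rewrite /= mul0r.
Qed.

Lemma coefsCM (c : R) f n : (fpsC c * f) n = c * f n.
Proof.
rewrite coefsM big_ord_recl /= subn0 big1 ?addr0 // => i _.
by rewrite /= mul0r.
Qed.

Lemma fpsC1 : fpsC 1 = 1 :> fps R.
Proof. by []. Qed.

Lemma fpsC0 : fpsC 0 = 0 :> fps R.
Proof. by apply: fpsP => n /=; case: ifP. Qed.

Lemma fpsCM (a b : R) : fpsC (a * b) = fpsC a * fpsC b.
Proof. by apply: fpsP => n; rewrite coefsCM /=; case: ifP; rewrite ?mulr0. Qed.

Lemma fpsCB (a b : R) : fpsC (a - b) = fpsC a - fpsC b.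
Proof. by apply: fpsP => n; rewrite coefsB /=; case: ifP; rewrite ?subr0. Qed.

Lemma fpsCX (c : R) k : fpsC (c ^+ k) = fpsC c ^+ k.
Proof. by elim: k => // k IH; rewrite !exprS fpsCM IH. Qed.

Lemma coefsXn k n : (fpsX ^+ k : fps R) n = (n == k)%:R.
Proof.
elim: k n => [|k IH] n; first by rewrite expr0 coefs1.
by rewrite exprS coefsXM; case: n => [|n] //; rewrite IH.
Qed.

Lemma coefs_compCX (c : R) f n : fps_comp f (fpsC c * fpsX) n = f n * c ^+ n.
Proof.
rewrite /= big_ord_recr /= big1 => [|i _]; last first.
  rewrite exprMn -fpsCX coefsCM coefsXn.
  by rewrite eqn_leq leqNgt ltn_ord mulr0 mulr0.
by rewrite add0r exprMn -fpsCX coefsCM coefsXn eqxx mulr1.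
Qed.

End FpsTheory.

Section Paths.
Variables (R : comNzRingType) (x y : R).

(* The weight of a letter a that starts at level v. *)
Definition omega (v : int) : R :=
  match v with Posz n => y ^+ n | Negz n => x ^+ n.+1 end.

Lemma omegaS (h : int) : 0 <= h -> omega (h + 1) = y * omega h.
Proof. by case: h => // n _; rewrite -exprS -[_ + 1]/(Posz (n + 1)) addn1. Qed.

Lemma omegaP (h : int) : h <= 0 -> omega (h - 1) = x * omega h.
Proof.
case: h => [[|n]|n] // _; first by rewrite /= mulr1.
have -> : Negz n - 1 = Negz n.+1 by rewrite !NegzE; lia.
by rewrite -exprS.
Qed.

Fixpoint paths (N : nat) (h g : int) : R :=
  if N is N'.+1 then omega h * paths N' (h + 1) g + paths N' (h - 1) g
  else (h == g)%:R.

Lemma paths_last N h g :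
  paths N.+1 h g = omega (g - 1) * paths N h (g - 1) + paths N h (g + 1).
Proof.
elim: N h => [|N IH] h.
  rewrite /= (_ : (h + 1 == g) = (h == g - 1)); last by lia.
  rewrite (_ : (h - 1 == g) = (h == g + 1)); last by lia.
  by case: eqP => [->|] //; rewrite !mulr0.
by rewrite [LHS]/= -/(paths N.+1 _ _) -/(paths N.+1 _ _) !IH /=; ring.
Qed.

(** Extended by 0 to negative lengths, so that the recursion holds for all integers. *)
Definition pathsZ (N h g : int) : R := if N is Posz n then paths n h g else 0.

Lemma pathsZ_rec N h g :
  pathsZ N h g = ((N == 0) && (h == g))%:R +
    omega h * pathsZ (N - 1) (h + 1) g + pathsZ (N - 1) (h - 1) g.
Proof.
case: N => [[|N]|N].
- by rewrite sub0r /= mulr0 !addr0.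
- by rewrite (_ : Posz N.+1 - 1 = N) ?add0r //; lia.
- have -> : Negz N - 1 = Negz N.+1 by rewrite !NegzE; lia.
  by rewrite /= mulr0 !addr0.
Qed.

Lemma pathsZ_small N h g : N < h - g -> pathsZ N h g = 0.
Proof.
case: N => // N; elim: N h => [|N IH] h /= ltN.
  by have -> : (h == g) = false by lia.
by move: IH; rewrite /= => IH; rewrite !IH ?mulr0 ?addr0 //; lia.
Qed.

(* A path from h to g with m letters a has length h + 2m - g. *)
Definition path_series (g h : int) : fps R :=
  Fps (fun m : nat => pathsZ (h + m%:Z * 2 - g) h g).

Lemma path_series_rec g h :
  path_series g h = fpsC (h == g)%:R +
    fpsX * (fpsC (omega h) * path_series g (h + 1)) + path_series g (h - 1).
Proof.
apply: fpsP => m; rewrite !coefsD coefsXM [LHS]pathsZ_rec.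
congr (_ + _ + pathsZ _ _ _); last by lia.
  have -> : (h + m%:Z * 2 - g == 0) && (h == g) = (m == 0%N) && (h == g) by lia.
  by rewrite /=; case: ifP.
(* With no letter a to spend, a path of length [h - g - 1] cannot come down from [h + 1] to [g]. *)
case: m => [|m]; first by rewrite pathsZ_small ?mulr0 //; lia.
by rewrite coefsCM; congr (_ * pathsZ _ _ _); lia.
Qed.

End Paths.

Section Excursions.
Variables (R : comNzRingType) (q : R).

(* The paths of length N from level h to 0 that stay nonnegative; the exponent
   h.+1 makes an excursion of semi-length m weigh q^(area + m), as in C(q, qz). *)
Fixpoint excursion_sum (N h : nat) : R :=
  if N is N'.+1 then q ^+ h.+1 * excursion_sum N' h.+1 +
    (if h is h'.+1 then excursion_sum N' h' else 0)
  else (h == 0%N)%:R.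

Lemma excursion_sum_small N h : (N < h)%N -> excursion_sum N h = 0.
Proof.
elim: N h => [|N IH] [|h] //= ltNh.
by rewrite !IH ?mulr0 ?addr0 // ltnW // ltnW.
Qed.

Definition excursion_series (h : nat) : fps R := Fps (fun m => excursion_sum (m.*2 + h) h).

Lemma excursion_series0 : excursion_series 0 = 1 + fpsX * (fpsC q * excursion_series 1).
Proof.
apply: fpsP => m; rewrite coefsD coefsXM coefs1.
case: m => [|m]; first by rewrite /= addr0.
by rewrite coefsCM /= addr0 add0r addn0 addn1 expr1.
Qed.

Lemma excursion_series_S h :
  excursion_series h.+1 = fpsX * (fpsC (q ^+ h.+2) * excursion_series h.+2) + excursion_series h.
Proof.
apply: fpsP => m; rewrite coefsD coefsXM.
case: m => [|m]; first by rewrite /= excursion_sum_small ?mulr0 ?add0r.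
by rewrite coefsCM /= -!addSnnS.
Qed.

End Excursions.

(** * First passages through the levels 0 and 1 *)

Section FirstPassage.
Variables (R : comNzRingType) (x y : R).

(** Each right-hand side involves a lower degree or, at the same degree, a lower level; hence an
    induction on the degree, then on the level. *)
Lemma up_system_trivial (U : nat -> fps R) (a : nat -> R) :
    U 0%N = fpsX * (fpsC (a 0%N) * U 1%N) ->
    (forall n, U n.+1 = fpsX * (fpsC (a n.+1) * U n.+2) + U n) ->
  forall n, U n = 0.
Proof.
move=> U0 US; suff UE m n : U n m = 0 by move=> n; apply: fpsP => m; rewrite UE.
elim: m n => [|m IHm]; elim => [|n IHn].
- by rewrite U0 coefsXM.
- by rewrite US coefsD coefsXM IHn addr0.
- by rewrite U0 coefsXM coefsCM IHm mulr0.
- by rewrite US coefsD coefsXM coefsCM IHm IHn mulr0 addr0.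
Qed.

(** At a fixed degree this recursion leads to ever larger [n]. Once the lower degree vanishes, it
    makes [V n m] independent of [n], and the last hypothesis gives 0 for large [n]. *)
Lemma down_system_trivial (V : nat -> fps R) (a : nat -> R) :
    V 0%N = V 1%N ->
    (forall n, V n.+1 = fpsX * (fpsC (a n) * V n) + V n.+2) ->
    (forall n m, (m.*2 < n)%N -> V n m = 0) ->
  forall n, V n = 0.
Proof.
move=> V0 VS Vsmall.
suff VE m n : V n m = 0 by move=> n; apply: fpsP => m; rewrite VE.
suff stable m' : m' = m -> V n m' = V (n + m.*2.+1)%N m'.
  by rewrite stable // Vsmall // addnC addSn ltnS leq_addr.
elim: m m' n => [|m IHm] m' n ->.
  suff step k : V k 0%N = V k.+1 0%N by rewrite addn1 step.
  by case: k => [|k]; rewrite ?V0 // VS coefsD coefsXM add0r.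
have Vm k : V k m = 0 by rewrite IHm // Vsmall // addnC addSn ltnS leq_addr.
have step k : V k m.+1 = V k.+1 m.+1.
  by case: k => [|k]; rewrite ?V0 // VS coefsD coefsXM coefsCM Vm mulr0 add0r.
by elim: _.*2.+1 => [|j IHj]; rewrite ?addn0 // addnS -step.
Qed.

(** Before its first step to level 0 the path is an excursion above level 1, where an a at height j
    above level 1 weighs y^(j+1), as in [excursion_sum]. Without such a step the path ends at 1. *)
Lemma path_series_above (g : int) : g <= 1 ->
  path_series x y g 1 = excursion_series y 0 * (fpsC (1 == g)%:R + path_series x y g 0).
Proof.
move=> g_le1; apply/eqP; rewrite -subr_eq0; apply/eqP.
(* All starting levels [n + 1] are treated at once, so that the recursion closes. *)
pose U n := path_series x y g n.+1%:Z -
  excursion_series y n * (fpsC (1 == g)%:R + path_series x y g 0).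
apply: (@up_system_trivial U (fun n => y ^+ n.+1)) => [|n] /=.
  rewrite /U path_series_rec excursion_series0 subrr /= expr1 -[1 + 1]/(2%:Z); ring.
rewrite /U [in LHS]path_series_rec excursion_series_S.
have -> : (n.+2%:Z == g) = false by lia.
have -> : n.+2%:Z + 1 = n.+3 by lia.
have -> : n.+2%:Z - 1 = n.+1 by lia.
rewrite fpsC0 /=; ring.
Qed.

(** Mirror image: an excursion below level 0 either is the whole path or is followed by an a from 0
    to 1, which has weight 1 and is marked by [fpsX]. *)
Lemma path_series_below (g : int) : 0 <= g ->
  path_series x y g 0 = excursion_series x 0 * (fpsC (0 == g)%:R + fpsX * path_series x y g 1).
Proof.
move=> g_ge0; apply/eqP; rewrite -subr_eq0; apply/eqP.
set K := fpsC _ + _.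
(* Reflecting the levels exchanges a and b; charging the weight to the letters b
   instead leaves the factor x^(1 + ... + n) for the n unmatched letters a. *)
pose V n := path_series x y g (- n%:Z) -
  fpsX ^+ n * fpsC (x ^+ 'C(n.+1, 2)) * excursion_series x n * K.
suff /(_ 0%N) <- : forall n, V n = 0 by rewrite /V expr0 /= !mul1r oppr0.
apply: (@down_system_trivial V (fun n => x ^+ n.+1)) => [|n|n m lt_mn].
- rewrite /V path_series_rec excursion_series0 oppr0 /= fpsC1 -[0 + 1]/(1%:Z) -[0 - 1]/(-1%:Z).
  by rewrite expr1 /= /K; ring.
- have -> : V n.+1 = path_series x y g (- n.+1%:Z) -
     fpsX ^+ n.+1 * fpsC (x ^+ 'C(n.+2, 2)) *
       (excursion_series x n + fpsX * (fpsC (x ^+ n.+2) * excursion_series x n.+2)) * K.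
    by rewrite /V excursion_series_S [excursion_series x n + _]addrC.
  rewrite /V path_series_rec.
  have -> : (- n.+1%:Z == g) = false by lia.
  have -> : - n.+1%:Z + 1 = - n%:Z by lia.
  have -> : - n.+1%:Z - 1 = - n.+2%:Z by lia.
  have -> : omega x y (- n.+1%:Z) = x ^+ n.+1 by [].
  rewrite (binS n.+2) (binS n.+1) !bin1 !exprD !fpsCM fpsC0 !exprS; ring.
- rewrite /V coefsB -!mulrA.
  have -> : forall f : fps R, (fpsX ^+ n * f) m = 0.
    have {lt_mn} lt_mn : (m < n)%N by lia.
    elim: n m lt_mn {V} => // n IH m lt_mn f; rewrite exprS -mulrA coefsXM.
    by case: m lt_mn => // m /IH->.
  (* The length is negative here, where [pathsZ] is 0 by definition. *)
  have /= : - n%:Z + m%:Z * 2 - g < 0 by lia.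
  by rewrite subr0; case: (- n%:Z + _ - g) => // k.
Qed.

End FirstPassage.

Section Green.
Variables (R : comNzRingType) (x y : R).
Let D := excursion_series y 0.
Let E := excursion_series x 0.

(** A path from 1 to 0 that starts with b continues from 0 to 0, so the inner difference keeps the
    paths that start with a. The first-passage equations are linear systems for the series between
    the levels 0 and 1. *)
Lemma path_series_total :
  (path_series x y 1 1 - (path_series x y 0 1 - path_series x y 0 0)) *
  (1 - fpsX * E * D) = E + D - E * D.
Proof.
have P11 := @path_series_above _ x y 1 isT.
have P10 := @path_series_below _ x y 1 isT.
have P01 := @path_series_above _ x y 0 isT.
have P00 := @path_series_below _ x y 0 isT.
rewrite /= fpsC1 fpsC0 -/D -/E in P11 P10 P01 P00.
have a : path_series x y 1 1 * (1 - fpsX * E * D) = D.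
  by rewrite mulrBr mulr1 {1}P11 P10; ring.
have b : path_series x y 0 0 * (1 - fpsX * E * D) = E.
  by rewrite mulrBr mulr1 {1}P00 P01; ring.
rewrite P01 add0r.
transitivity (path_series x y 1 1 * (1 - fpsX * E * D) +
   (1 - D) * (path_series x y 0 0 * (1 - fpsX * E * D))); first by ring.
by rewrite a b; ring.
Qed.
End Green.

(** * Words and excursions *)

Section Words.
Implicit Types u v w : seq bool.

Definition step (c : bool) : int := if c then 1 else -1.

Lemma delta_cons c u : delta (c :: u) = step c + delta u.
Proof. by rewrite /delta /=; case: c; rewrite /step ?add0n ?add1n; lia. Qed.

Lemma delta_cat u v : delta (u ++ v) = delta u + delta v.
Proof. by rewrite /delta !count_cat; lia. Qed.

Lemma size_count_ab u : size u = (count_mem true u + count_mem false u)%N.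
Proof.
rewrite -(count_predC (pred1 true)); congr (_ + _)%N.
by apply: eq_count => -[].
Qed.

Lemma sum_tuple_cons (V : nmodType) N (P : pred (seq bool)) (F : seq bool -> V) :
  \sum_(t : N.+1.-tuple bool | P t) F t =
  \sum_(t : N.-tuple bool | P (true :: t)) F (true :: t) +
  \sum_(t : N.-tuple bool | P (false :: t)) F (false :: t).
Proof.
pose cns (p : bool * N.-tuple bool) := [tuple of p.1 :: p.2].
pose unc (t : N.+1.-tuple bool) := (thead t, [tuple of behead t]).
have cnsK : cancel cns unc.
  by case=> c t; rewrite /unc theadE; congr (_, _); apply: val_inj.
have uncK : cancel unc cns by move=> t; rewrite [RHS]tuple_eta.
rewrite big_mkcond (reindex cns) /=; last by exists unc => p _.
rewrite -(pair_bigA _ (fun c t => if P (c :: tval t) then F (c :: tval t) else 0)).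
by rewrite big_bool /= -!big_mkcond.
Qed.


Definition weight (R : comNzRingType) (F : int -> R) (h : int) u : R :=
  \prod_(k < size u | nth false u k) F (h + delta (take k u)).

Lemma weight_cons (R : comNzRingType) (F : int -> R) h c u :
  weight F h (c :: u) = (if c then F h else 1) * weight F (h + step c) u.
Proof.
rewrite /weight /= big_mkcond big_ord_recl /= addr0 -big_mkcond /=.
by congr (_ * _); apply: eq_bigr => k _; rewrite delta_cons (addrA h).
Qed.

Lemma weight_cat (R : comNzRingType) (F : int -> R) h u v :
  weight F h (u ++ v) = weight F h u * weight F (h + delta u) v.
Proof.
elim: u h => [|c u IH] h; first by rewrite [X in X * _]big_ord0 mul1r addr0.
by rewrite cat_cons !weight_cons IH delta_cons mulrA -[h + step c + _]addrA.
Qed.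

Lemma sum_weight_paths (R : comNzRingType) (x y : R) N h g :
  \sum_(t : N.-tuple bool | h + delta t == g) weight (omega x y) h t =
  paths x y N h g.
Proof.
elim: N h => [|N IH] h.
  rewrite big_mkcond (big_pred1 [tuple]) => [|t]; last by apply/esym/eqP; exact: tuple0.
  by rewrite addr0 /weight big_ord0 /=; case: ifP.
rewrite (sum_tuple_cons N (fun u => h + delta u == g) (weight (omega x y) h)) /= -!IH big_distrr.
by congr (_ + _); apply: eq_big => t; rewrite ?delta_cons ?(addrA h) // weight_cons ?mul1r.
Qed.

Definition excursion (h : int) u : bool :=
  all (fun i => 0 <= h + delta (take i u)) (iota 0 (size u).+1) &&
  (h + delta u == 0).

Lemma excursion_cons h c u :
  excursion h (c :: u) = (0 <= h) && excursion (h + step c) u.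
Proof.
rewrite /excursion /= addr0 -andbA; congr (_ && _).
rewrite delta_cons (addrA h); congr (_ && _).
2: by rewrite delta_cons (addrA h).
congr (_ && _); rewrite -[iota 2 _]/(iota (1 + 1) _) iotaDl all_map.
by apply: eq_all => i /=; rewrite delta_cons (addrA h).
Qed.

Lemma excursion_ge0 h u : excursion h u -> 0 <= h.
Proof. by case/andP => /= /andP[]; rewrite take0 addr0. Qed.

Lemma sum_weight_excursion (R : comNzRingType) (q : R) N (h : nat) :
  \sum_(t : N.-tuple bool | excursion h t) weight (fun j => q ^+ `|j|.+1) h t =
  excursion_sum q N h.
Proof.
elim: N h => [|N IH] h.
  rewrite big_mkcond (big_pred1 [tuple]) => [|t]; last by apply/esym/eqP; exact: tuple0.
  rewrite /excursion /weight big_ord0 /= addr0.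
  by have -> : (h == 0 :> int) = (h == 0%N) by []; case: h.
rewrite (sum_tuple_cons N (excursion h) (weight (fun j => q ^+ `|j|.+1) h)) /=.
congr (_ + _).
  rewrite -IH big_distrr; apply: eq_big => t; rewrite ?excursion_cons -?PoszD ?addn1 //.
  by rewrite weight_cons -PoszD addn1.
case: h => [|h].
  rewrite big1 // => t; rewrite excursion_cons => /andP[_ /excursion_ge0].
  by [].
have hE : h.+1%:Z + step false = h by rewrite /step; lia.
rewrite -IH; apply: eq_big => t; rewrite ?excursion_cons ?hE //.
by rewrite weight_cons hE mul1r.
Qed.

Definition positions_a u := [seq k <- iota 0 (size u) | nth letter_b u k == letter_a].

Lemma size_positions_a u : size (positions_a u) = count_mem letter_a u.
Proof.
rewrite size_filter -[u in RHS](mkseq_nth letter_b) count_map.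
by apply: eq_count => i /=.
Qed.

(** Heights and rows of the strip are indexed by the occurrences of a, weights by positions; this
    converts one indexing into the other. *)
Lemma big_occurrences (R : Type) (idx : R) (op : Monoid.com_law idx) (G : nat -> R) u :
  \big[op/idx]_(i < count_mem letter_a u) G (nth 0%N (positions_a u) i) =
  \big[op/idx]_(k < size u | nth letter_b u k) G k.
Proof.
rewrite -size_positions_a -(big_mkord xpredT (fun i => G (nth _ _ i))).
rewrite -(big_nth 0%N xpredT) big_filter -(big_mkord (nth letter_b u)) /index_iota subn0.
by apply: eq_bigl => k; case: nth.
Qed.

Lemma dyck_excursion u : dyck u = excursion 0 u.
Proof.
rewrite /dyck /excursion andbC; congr (_ && _); last by rewrite /delta; lia.
by apply: eq_all => i; rewrite add0r.
Qed.

Lemma weight_dyck (R : comNzRingType) (q : R) u :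
  dyck u ->
  weight (fun j => q ^+ `|j|.+1) 0 u = q ^+ `|area u| * q ^+ count_mem letter_a u.
Proof.
case/andP=> _ /allP u_ge0; rewrite /weight.
rewrite -(big_occurrences _ (fun k => q ^+ `|0 + delta (take k u)|.+1)) -exprD.
under eq_bigr do rewrite add0r.
rewrite -expr_sum; congr (_ ^+ _).
under eq_bigr do rewrite -addn1.
rewrite big_split /= sum_nat_const card_ord muln1; congr (_ + _)%N.
apply/eqP; rewrite -eqz_nat; apply/eqP.
have delta_ge0 i : 0 <= delta (take (nth 0%N (positions_a u) i) u).
  have [lt_is|le_si] := ltnP i (size (positions_a u)); last first.
    by rewrite (nth_default _ le_si) take0.
  apply: u_ge0; have := mem_nth 0%N lt_is.
  by rewrite mem_filter !mem_iota /= !add0n => /andP[_ /leqW].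
rewrite gez0_abs; last by apply: sumr_ge0 => i _; apply: delta_ge0.
rewrite /area -[Posz (\sum_(i < _) _)]natz natr_sum; apply: eq_bigr => i _.
by rewrite natz gez0_abs.
Qed.

End Words.

(** Substituting qt for t multiplies the n-th coefficient by q^n, which accounts for the extra 1 per
    letter a in the weight of an excursion. *)
Lemma C_excursion_series (R : comNzRingType) (q : R) : C q (fpsC q * fpsX) = excursion_series q 0.
Proof.
apply: fpsP => n; rewrite /C coefs_compCX /= addn0 -addnn -sum_weight_excursion big_distrl.
apply: eq_big => t; rewrite inE.
  rewrite -dyck_excursion andb_idr // => /andP[/eqP ab _]; apply/eqP.
  by have := size_tuple t; rewrite size_count_ab -ab; lia.
by case/andP=> dt /eqP ab; rewrite weight_dyck // ab.
Qed.

(** * The cycle lemma *)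

Section CycleLemma.
Implicit Types u v w : seq bool.

Definition strict_nonneg u : bool :=
  all (fun i => 0 <= delta (take i u)) (iota 0 (size u)).

Lemma strict_nonnegP u :
  reflect (forall i, (i < size u)%N -> 0 <= delta (take i u)) (strict_nonneg u).
Proof.
apply: (iffP allP) => u_ge0 i; first by move=> lt_iu; apply: u_ge0; rewrite mem_iota.
by rewrite mem_iota => /andP[_]; apply: u_ge0.
Qed.

(** Position [k] of [u] moves cyclically to [k - i]; for [k < i] the prefix wraps around the end of
    [u], whence the extra [delta u]. *)
Lemma delta_take_rot u i k : (i <= size u)%N -> (k < size u)%N ->
  delta (take (if (k < i)%N then size u - i + k else k - i)%N (rot i u)) =
  delta (take k u) - delta (take i u) + (if (k < i)%N then delta u else 0).
Proof.
move=> le_iu lt_ku; rewrite /rot take_cat size_drop.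
have [lt_ki|le_ik] := ltnP k i.
  rewrite ltnNge leq_addr /= addKn take_takel 1?ltnW // delta_cat.
  have <- : delta (take i u) + delta (drop i u) = delta u.
    by rewrite -delta_cat cat_take_drop.
  by rewrite [RHS]addrA subrK addrC.
rewrite ltn_sub2r ?(leq_ltn_trans le_ik) // addr0 -{2}(subnKC le_ik) takeD delta_cat.
by rewrite addrAC subrr add0r.
Qed.

(** The condition says that [i] is the first index where the prefix levels attain their minimum,
    which determines [i]. Wrapped prefixes lose 1, hence the strict inequality. *)
Lemma strict_nonneg_rot u i : (i < size u)%N -> delta u = -1 ->
  strict_nonneg (rot i u) <->
  forall k, (k < size u)%N ->
    if (k < i)%N then delta (take i u) < delta (take k u)
    else delta (take i u) <= delta (take k u).
Proof.
move=> lt_iu du; split=> [/strict_nonnegP rot_ge0 k lt_ku|le_i].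
  have := delta_take_rot (ltnW lt_iu) lt_ku.
  have /rot_ge0 : ((if k < i then size u - i + k else k - i) < size (rot i u))%N.
    by rewrite size_rot; case: ifP; lia.
  by rewrite du; case: ifP => _; lia.
apply/strict_nonnegP => j; rewrite size_rot => lt_ju.
pose k := (if j < size u - i then j + i else j - (size u - i))%N.
have lt_ku : (k < size u)%N by rewrite /k; case: ifP; lia.
have -> : j = (if k < i then size u - i + k else k - i)%N.
  by rewrite /k; case: (ltnP j (size u - i)) => ?; case: ifP; lia.
have := le_i k lt_ku.
by rewrite (delta_take_rot (ltnW lt_iu) lt_ku) du; case: ifP => _; lia.
Qed.

Lemma exists_unique_strict_nonneg_rot u : delta u = -1 ->
  exists2 i, (i < size u)%N &
    forall j, (j < size u)%N -> strict_nonneg (rot j u) = (j == i).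
Proof.
move=> du; have [N Nu] : exists N, size u = N.+1.
  by case: u du => // c u _; exists (size u).
pose P i := (i < size u)%N &&
  all (fun k => delta (take i u) <= delta (take k u)) (iota 0 (size u)).
have exP : exists i, P i.
  case: (arg_minP (fun i : 'I_N.+1 => delta (take i u))
    (i0 := ord0) (P := xpredT)) => // i _ min_i.
  exists i; rewrite /P Nu ltn_ord; apply/allP => k.
  by rewrite mem_iota /= add0n => lt_kN; apply: (min_i (Ordinal lt_kN)).
case: (ex_minnP exP) => i /andP[lt_iu /allP min_i] first_i.
have good_i : strict_nonneg (rot i u).
  apply/(strict_nonneg_rot lt_iu du) => k lt_ku.
  case: ifP => lt_ki; last by apply: min_i; rewrite mem_iota.
  rewrite ltNge; apply/negP => le_ki.
  suff /first_i : P k by rewrite leqNgt lt_ki.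
  rewrite /P lt_ku; apply/allP => j j_in; exact: le_trans le_ki (min_i j j_in).
exists i => // j lt_ju; apply/idP/eqP => [good_j|-> //].
move/(strict_nonneg_rot lt_iu du): good_i => good_i.
move/(strict_nonneg_rot lt_ju du): good_j => good_j.
have := good_i j lt_ju; have := good_j i lt_iu.
by case: (ltngtP i j) => //; lia.
Qed.

Lemma delta_rot u i : delta (rot i u) = delta u.
Proof. by rewrite -[in RHS](cat_take_drop i u) delta_cat addrC -delta_cat. Qed.

(** Attach to each [u] its unique rotation [w] that is [strict_nonneg], exchange the sums and sum
    over [w] instead; [u] is the rotation of [w] by [N - i]. *)
Lemma sum_rotations (V : nmodType) N (f : seq bool -> V) :
  \sum_(u : N.-tuple bool | delta u == -1) f u =
  \sum_(w : N.-tuple bool | (delta w == -1) && strict_nonneg w)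
    \sum_(i < N) f (rot i w).
Proof.
transitivity (\sum_(u : N.-tuple bool | delta u == -1)
    \sum_(i < N | strict_nonneg (rot i u)) f u).
  apply: eq_bigr => u /eqP du; have := exists_unique_strict_nonneg_rot du.
  rewrite size_tuple => -[i lt_iN good_i].
  by rewrite (big_pred1 (Ordinal lt_iN)) // => j; rewrite good_i.
rewrite (exchange_big_dep xpredT) //= [RHS]exchange_big /=.
transitivity (\sum_(i < N) \sum_(w : N.-tuple bool | (delta w == -1) && strict_nonneg w)
   f (rot (N - i) w)).
  apply: eq_bigr => i _.
  rewrite (reindex (fun w : N.-tuple bool => [tuple of rotr i w])) /=; last first.
    exists (fun w : N.-tuple bool => [tuple of rot i w]) => w _;
      by apply: val_inj; rewrite /= ?rotrK ?rotK.
  apply: eq_big => w; last by rewrite /rotr size_tuple.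
  by rewrite rotrK /rotr delta_rot.
rewrite (reindex_inj rev_ord_inj) /=.
case: N => [|N]; first by rewrite !big_ord0.
(* The rotation amounts now run over 1, ..., N+1 instead of 0, ..., N; rotating by the full length
   N+1 is rotating by 0. *)
rewrite big_ord_recr [RHS]big_ord_recl /= addrC; congr (_ + _).
  apply: eq_bigr => w _.
  by rewrite subnn subn0 rot0 -[X in rot X _](size_tuple w) rot_size.
by apply: eq_bigr => i _; rewrite subKn // ltnW // ltnS ltn_ord.
Qed.

End CycleLemma.

(** * Cells of the strip *)

Section Strip.
Implicit Types u v w : seq bool.

Definition pos_part (z : int) : nat := if z is Posz n then n else 0%N.

Lemma omega_pos_part (R : comNzRingType) (x y : R) (h : int) :
  omega x y h = x ^+ pos_part (- h) * y ^+ pos_part h.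
Proof.
case: h => [[|n]|n]; first by rewrite oppr0 mulr1.
  by rewrite -NegzE /= mul1r.
by rewrite NegzE opprK /= mulr1.
Qed.

Lemma pos_partE (h : int) : (pos_part h)%:Z = if 0 <= h then h else 0.
Proof. by case: h. Qed.

Lemma card_rows m (lo : nat -> int) (len : nat -> nat) :
  #|` fset_set [set c : int * nat |
       (c.2 < m)%N /\ lo c.2 <= c.1 < lo c.2 + (len c.2)%:Z]%classic|
  = (\sum_(y < m) len y)%N.
Proof.
pose cells := [seq (lo y + i%:Z, y) | y <- iota 0 m, i <- iota 0 (len y)].
have cells_uniq : uniq cells.
  apply: allpairs_uniq_dep => [|y _|]; rewrite ?iota_uniq //.
  by move=> [y i] [y' i'] _ _ /= [/[swap] <-] /addrI[->].
have -> : [set c : int * nat | (c.2 < m)%N /\ lo c.2 <= c.1 < lo c.2 + (len c.2)%:Z]%classic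
    = [set` [fset c in cells]%fset]%classic.
  apply/seteqP; split=> -[a b] /=.
    case=> lt_bm /andP[le_a lt_a]; rewrite !inE; apply/allpairsPdep.
    exists b, `|a - lo b|%N; rewrite !mem_iota; split; try lia.
    by congr (_, _); lia.
  rewrite !inE => /allpairsPdep[y [i []]]; rewrite !mem_iota => y_in i_in [-> ->].
  by split; lia.
rewrite set_fsetK card_fseq undup_id // size_allpairs_dep.
rewrite sumnE big_map -[X in iota 0 X]subn0 -/(index_iota 0 m) big_mkord.
by apply: eq_bigr => y _; rewrite size_iota.
Qed.

Lemma positions_a_cons c u :
  positions_a (c :: u) =
  (if c then [:: 0%N] else [::]) ++ [seq k.+1 | k <- positions_a u].
Proof.
rewrite /positions_a /= -[iota 1 _]/(iota (1 + 0) _) iotaDl filter_map.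
by case: c.
Qed.

Lemma nth_positions_a_lt u y : (y < count_mem true u)%N ->
  (nth 0%N (positions_a u) y < size u)%N.
Proof.
rewrite -size_positions_a => /(mem_nth 0%N).
by rewrite mem_filter mem_iota => /andP[_ /andP[]].
Qed.

Lemma count_take_positions_a u y : (y < count_mem true u)%N ->
  count_mem true (take (nth 0%N (positions_a u) y) u) = y.
Proof.
elim: u y => // c u IH y; rewrite positions_a_cons; case: c => /=; last first.
  rewrite add0n => lt_y.
  by rewrite (nth_map 0%N) ?size_positions_a //= add0n IH.
case: y => [|y] //=; rewrite add1n ltnS => lt_y.
by rewrite (nth_map 0%N) ?size_positions_a //= add1n IH.
Qed.

Lemma leq_positions_a u y z :
    (y < count_mem true u)%N -> (z < count_mem true u)%N ->
  (nth 0%N (positions_a u) y <= nth 0%N (positions_a u) z)%N = (y <= z)%N.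
Proof.
move=> lt_y lt_z.
have mono a b : (a < count_mem true u)%N -> (b < count_mem true u)%N ->
    (nth 0%N (positions_a u) a <= nth 0%N (positions_a u) b)%N -> (a <= b)%N.
  move=> lt_a lt_b le_ab.
  rewrite -(count_take_positions_a lt_a) -(count_take_positions_a lt_b).
  by rewrite -(subnKC le_ab) takeD count_cat leq_addr.
apply/idP/idP; first exact: mono.
move=> le_yz; rewrite leqNgt; apply/negP => lt_pos.
have zy : z = y by apply/eqP; rewrite eqn_leq le_yz mono // ltnW.
by rewrite zy ltnn in lt_pos.
Qed.

(** The label is m (y - a) + y and must be less than m k + r. As [y] and [r] are below [m], the
    quotients are compared first, then the remainders. *)
Lemma label_le m k r a y : (r < m)%N -> (y < m)%N ->
  (label m.+1 (a, y) <= m%:Z * k + r%:Z - 1) = (y%:Z - k + (r <= y)%N%:Z <= a).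
Proof.
move=> lt_rm lt_ym; rewrite /label /=.
have -> : m.+1%:Z * y%:Z - (m.+1%:Z - 1) * a = m%:Z * (y%:Z - a) + y%:Z by lia.
have [le_ry|lt_yr] /= := leqP r y; apply/idP/idP; nia.
Qed.

(* For s = m k + r - 1 this is t - 1 - N, where t is the abscissa of the leftmost
   cell of row y with label <= s and N that of the north step. *)
Definition shifted_height w (k : int) (r y : nat) : int :=
  height w y - k + (r <= y)%N%:Z - 1.

Lemma height_abscissa w y : (y < count_mem true w)%N ->
  height w y = y%:Z - north_abscissa w y.
Proof.
by move=> lt_y; rewrite /height /delta {1}/prefix_before_a count_take_positions_a.
Qed.

(** Labels decrease eastwards, so in the notation of [shifted_height] the cells counted in a row
    have abscissas from t to N. *)
Lemma left_countE w m k r : count_mem true w = m -> (r < m)%N ->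
  left_count m.+1 w (m%:Z * k + r%:Z - 1) =
  (\sum_(y < m) pos_part (- shifted_height w k r y))%N.
Proof.
move=> wm lt_rm; rewrite /left_count.
rewrite -(card_rows m (fun y => y%:Z - k + (r <= y)%N%:Z)
  (fun y => pos_part (- shifted_height w k r y))).
congr (#|` fset_set _|); apply/seteqP; split=> -[a y] /= [].
  case=> /= lt_ym le_a; rewrite label_le // => le_ya; split=> //; rewrite le_ya /=.
  by rewrite pos_partE /shifted_height height_abscissa ?wm //; case: ifP; lia.
move=> lt_ym /andP[le_ya]; rewrite pos_partE /shifted_height height_abscissa ?wm // => lt_a.
rewrite label_le //; do 2?split=> //=.
by move: lt_a; case: ifP; lia.
Qed.

(** Here the abscissas run from N + 1 to t - 1, so no row contributes to both counts. *)
Lemma right_countE w m k r : count_mem true w = m -> (r < m)%N ->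
  right_count m.+1 w (m%:Z * k + r%:Z - 1) =
  (\sum_(y < m) pos_part (shifted_height w k r y))%N.
Proof.
move=> wm lt_rm; rewrite /right_count.
rewrite -(card_rows m (fun y => north_abscissa w y + 1)
  (fun y => pos_part (shifted_height w k r y))).
congr (#|` fset_set _|); apply/seteqP; split=> -[a y] /= [].
  case=> /= lt_ym le_a; rewrite ltNge label_le // => le_ya; split=> //.
  by rewrite pos_partE /shifted_height height_abscissa ?wm //; case: ifP; lia.
move=> lt_ym /andP[le_ya]; rewrite pos_partE /shifted_height height_abscissa ?wm // => lt_a.
rewrite ltNge label_le //; do 2?split=> //=.
  by lia.
by move: lt_a; case: ifP; lia.
Qed.

(** If [delta (u ++ v)] is -1, the left-hand side is the weight of the rotation [v ++ u]: the
    letters of [u] are read one period later, hence one level lower. *)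
Lemma weight_swap (R : comNzRingType) (F : int -> R) c u v :
  weight F (c + delta u) v * weight F (c - 1) u =
  \prod_(p < size (u ++ v) | nth false (u ++ v) p)
    F (delta (take p (u ++ v)) + c + (size u <= p)%N%:Z - 1).
Proof.
rewrite size_cat big_split_ord mulrC; congr (_ * _); apply: eq_big => p /=.
- by rewrite nth_cat ltn_ord.
- move=> _; congr F; rewrite takel_cat ?(ltnW (ltn_ord p)) //.
  by rewrite leqNgt ltn_ord /=; lia.
- by rewrite nth_cat ltnNge leq_addr addKn.
- move=> _; congr F; rewrite leq_addr take_cat ltnNge leq_addr addKn delta_cat /=.
  by lia.
Qed.

(** The indicator in [shifted_height] puts the rows below [r] one level lower than the others; so
    does starting the period at the letter a of row [r], which moves the earlier letters to the
    end. *)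
Lemma strip_weight (R : comNzRingType) (x y : R) w m k r :
    delta w = -1 -> count_mem true w = m -> (r < m)%N ->
  x ^+ left_count m.+1 w (m%:Z * k + r%:Z - 1) *
  y ^+ right_count m.+1 w (m%:Z * k + r%:Z - 1) =
  weight (omega x y) (height w r - k) (rot (nth 0%N (positions_a w) r) w).
Proof.
move=> dw wm lt_rm; rewrite left_countE // right_countE // !expr_sum -big_split /=.
under eq_bigr do rewrite -omega_pos_part.
set p := nth _ _ _; have lt_pw : (p < size w)%N by rewrite nth_positions_a_lt ?wm.
transitivity (\prod_(q < size w | nth false w q)
    omega x y (delta (take q w) + - k + (p <= q)%N%:Z - 1)).
  rewrite -(big_occurrences _ (fun q =>
    omega x y (delta (take q w) + - k + (p <= q)%N%:Z - 1))) wm.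
  by apply: eq_bigr => i _; rewrite leq_positions_a ?wm.
have pw : size (take p w) = p by rewrite size_takel // ltnW.
have := weight_swap (omega x y) (- k) (take p w) (drop p w).
rewrite cat_take_drop pw => <-; rewrite /rot weight_cat /height /prefix_before_a -/p.
have dd : delta (take p w) + delta (drop p w) = -1 by rewrite -delta_cat cat_take_drop.
by congr (weight _ _ _ * weight _ _ _); lia.
Qed.

End Strip.

(** * Summing over the starting level *)

Section Telescope.
Variables (R : comNzRingType) (x y : R).

(** This is E_a(h), and [closed_paths] is B(h), for [N] = 2m; in E_a(h), [N] counts the letters
    after the initial a. *)
Definition cyclic_paths (N : nat) (h : int) : R :=
  omega x y h * paths x y N (h + 1) (h - 1).

Definition closed_paths (N : nat) (h : int) : R := paths x y N h h.

(** Both sides weigh the paths of N + 1 letters from h + 1 to h that end with a. On the right, all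
    paths are split by their first letter and those ending with b are removed. *)
Lemma cyclic_paths_rot N h :
  omega x y (h - 1) * paths x y N (h + 1) (h - 1) =
  cyclic_paths N (h + 1) + closed_paths N h - closed_paths N (h + 1).
Proof.
have := paths_last x y N (h + 1) h; rewrite [LHS]/= addrK => E.
by rewrite /cyclic_paths /closed_paths addrK E addrK.
Qed.

Lemma cyclic_paths_pos N h : 1 <= h ->
  cyclic_paths N h =
  y * (cyclic_paths N (h + 1) + closed_paths N h - closed_paths N (h + 1)).
Proof.
move=> h_ge1; rewrite -cyclic_paths_rot mulrA -omegaS ?subrK //; lia.
Qed.

Lemma cyclic_paths_npos N h : h <= 0 ->
  x * cyclic_paths N h =
  cyclic_paths N (h + 1) + closed_paths N h - closed_paths N (h + 1).
Proof. by move=> h_le0; rewrite -cyclic_paths_rot omegaP // mulrA. Qed.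

(** The sum over all levels is infinite, so it is cut to -H < h <= H. The last two lines are the
    boundary terms of the telescoping; for N > 0 they vanish in any given bidegree once H is
    large. *)
Lemma sum_cyclic_paths N H :
  (1 - x) * (1 - y) *
    (\sum_(i < H) cyclic_paths N (- i%:Z) + \sum_(i < H) cyclic_paths N (i%:Z + 1)) =
  (1 - x * y) * (closed_paths N 1 - cyclic_paths N 1) +
  (1 - x) * y * (cyclic_paths N (H%:Z + 1) - closed_paths N (H%:Z + 1)) +
  (1 - y) * (cyclic_paths N (1 - H%:Z) - closed_paths N (1 - H%:Z)).
Proof.
have pos : (1 - y) * \sum_(i < H) cyclic_paths N (i%:Z + 1) =
    y * (closed_paths N 1 - cyclic_paths N 1 +
         cyclic_paths N (H%:Z + 1) - closed_paths N (H%:Z + 1)).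
  elim: H => [|H IH]; first by rewrite big_ord0 add0r; ring.
  rewrite big_ord_recr mulrDr IH /= [_ * cyclic_paths _ _]mulrBl mul1r.
  rewrite [X in _ + (X - _)]cyclic_paths_pos; last by lia.
  rewrite -[H.+1]addn1 PoszD; ring.
have npos : (1 - x) * \sum_(i < H) cyclic_paths N (- i%:Z) =
    closed_paths N 1 - cyclic_paths N 1 +
    cyclic_paths N (1 - H%:Z) - closed_paths N (1 - H%:Z).
  elim: H {pos} => [|H IH]; first by rewrite big_ord0 subr0; ring.
  rewrite big_ord_recr mulrDr IH /= [_ * cyclic_paths _ _]mulrBl mul1r.
  rewrite [X in _ + (_ - X)]cyclic_paths_npos; last by lia.
  have -> : - H%:Z + 1 = 1 - H%:Z by lia.
  have -> : 1 - H.+1%:Z = - H%:Z by lia.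
  ring.
rewrite mulrDr -(mulrA (1 - x) (1 - y) (\sum_(i < H) cyclic_paths N (i%:Z + 1))) pos.
rewrite [_ * _ * \sum_(i < H) _]mulrAC npos; ring.
Qed.

Lemma omega_ge (d : nat) h : d%:Z <= h -> exists r, omega x y h = y ^+ d * r.
Proof.
case: h => // n le_dn; exists (y ^+ (n - d)).
by rewrite -exprD subnKC.
Qed.

Lemma omega_le (d : nat) h : h <= - d%:Z -> exists r, omega x y h = x ^+ d * r.
Proof.
case: h => [n|n] le_d; last first.
  by exists (x ^+ (n.+1 - d)); rewrite -exprD subnKC //; rewrite NegzE in le_d; lia.
have -> : d = 0%N by lia.
by exists (omega x y n); rewrite mul1r.
Qed.

(** The endpoint rules out the path made of b only, so there is a first a; it starts at some
    [h - k], and its weight supplies the factor [c]. *)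
Lemma paths_dvd (c : R) (P : int -> Prop) N h g :
    (forall k : nat, (k <= N)%N -> P (h - k%:Z)) ->
    (forall h, P h -> exists r, omega x y h = c * r) ->
  h - N%:Z != g -> exists r, paths x y N h g = c * r.
Proof.
move=> Ph omegaP; elim: N h Ph => [|N IH] h Ph.
  by rewrite subr0 => /negPf /= ->; exists 0; rewrite mulr0.
move=> neq; have [r Er] : exists r, omega x y h = c * r.
  by apply: omegaP; rewrite -[h]subr0; apply: Ph.
have [||s Es] := IH (h - 1).
- move=> k le_kN; have -> : h - 1 - k%:Z = h - k.+1%:Z by lia.
  exact: Ph.
- by apply: contra_neq neq => <-; lia.
exists (r * paths x y N (h + 1) g + s).
by rewrite /= Er Es mulrDr mulrA.
Qed.

End Telescope.

(** * Series without terms of low bidegree *)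

Section Small.
Implicit Types f g : fps (fps int).

(** This replaces limits: two series are equal once their difference is small for every [d]. *)
Definition small (d : nat) f : Prop :=
  forall i j, (i < d)%N -> (j < d)%N -> f j i = 0.

Lemma small_eq0 f : (forall d, small d f) -> f = 0.
Proof.
move=> f_small; apply: fpsP => j; apply: fpsP => i.
by apply: (f_small (i + j).+1); rewrite ltnS ?leq_addr ?leq_addl.
Qed.

Lemma smallD d f g : small d f -> small d g -> small d (f + g).
Proof. by move=> sf sg i j ? ?; rewrite !coefsD sf ?sg. Qed.

Lemma smallN d f : small d f -> small d (- f).
Proof. by move=> sf i j ? ?; rewrite !coefsN sf ?oppr0. Qed.

Lemma smallM d f g : small d g -> small d (f * g).
Proof.
move=> sg i j lt_i lt_j; rewrite coefsM coefs_sum big1 // => k _.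
rewrite coefsM big1 // => l _; rewrite sg ?mulr0 //.
  exact: leq_ltn_trans (leq_subr _ _) lt_i.
exact: leq_ltn_trans (leq_subr _ _) lt_j.
Qed.

Lemma small_ypow d f : small d (fpsX ^+ d * f).
Proof.
move=> i j _ lt_jd; rewrite coefsM coefs_sum big1 // => k _.
rewrite coefsXn; have -> : (k == d :> nat) = false by have := ltn_ord k; lia.
by rewrite mul0r.
Qed.

Lemma small_xpow d f : small d (fpsC fpsX ^+ d * f).
Proof.
move=> i j lt_id _; rewrite -fpsCX coefsCM coefsM big1 // => k _.
rewrite coefsXn; have -> : (k == d :> nat) = false by have := ltn_ord k; lia.
by rewrite mul0r.
Qed.

End Small.

Lemma fps_unit_1B (R : comUnitRingType) (f : fps R) :
  (1 - f \is a GRing.unit) = (1 - f 0%N \is a GRing.unit).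
Proof. by rewrite fps_unitE coefsB coefs1. Qed.

Lemma geometric_sum (R : comUnitRingType) (a b : R) :
    1 - a \is a GRing.unit -> 1 - b \is a GRing.unit ->
  (1 - a) * (1 - b) * (a / (1 - a) + 1 / (1 - b)) = 1 - a * b.
Proof.
move=> /mulrV; move: (1 - a)^-1 => a' Ea /mulrV; move: (1 - b)^-1 => b' Eb.
transitivity (a * (1 - b) * ((1 - a) * a') + (1 - a) * ((1 - b) * b')); first by ring.
by rewrite Ea Eb; ring.
Qed.

(** * Evaluation of L_n *)

Section Lseries.
Let x0 : fps (fps int) := fpsC fpsX.
Let y0 : fps (fps int) := fpsX.
Implicit Types u w : seq bool.

Lemma small_omega d f h : d%:Z <= `|h| -> small d (omega x0 y0 h * f).
Proof.
have [h_ge0|h_lt0] := leP 0 h => le_dh.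
  have [|r ->] := @omega_ge _ x0 y0 d h; first by lia.
  by rewrite -mulrA; apply: small_ypow.
have [|r ->] := @omega_le _ x0 y0 d h; first by lia.
by rewrite -mulrA; apply: small_xpow.
Qed.

(** Within [N] letters the level stays at distance at least [d] from 0, and a closed path of
    positive length contains an a. *)
Lemma small_closed_paths d N h : (0 < N)%N -> N%:Z + d%:Z <= `|h| ->
  small d (closed_paths x0 y0 N h).
Proof.
move=> N_gt0; have [h_ge0|h_lt0] := leP 0 h => le_dh; rewrite /closed_paths.
  have [|||r ->] := @paths_dvd _ x0 y0 (y0 ^+ d) (fun v => d%:Z <= v) N h h.
  - by move=> k; lia.
  - exact: omega_ge.
  - by lia.
  exact: small_ypow.
have [|||r ->] := @paths_dvd _ x0 y0 (x0 ^+ d) (fun v => v <= - d%:Z) N h h.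
- by move=> k; lia.
- exact: omega_le.
- by lia.
exact: small_xpow.
Qed.

Definition window (H : nat) : seq int :=
  [seq - i%:Z | i <- iota 0 H] ++ [seq i%:Z + 1 | i <- iota 0 H].

Lemma mem_window H h : (h \in window H) = (- H%:Z < h <= H%:Z).
Proof.
rewrite mem_cat; apply/orP/idP => [[] /mapP[i]|]; rewrite ?mem_iota.
- by move=> ? ->; lia.
- by move=> ? ->; lia.
move=> h_in; have [h_gt0|h_le0] := ltP 0 h; [right | left]; apply/mapP.
  by exists `|h - 1|%N; rewrite ?mem_iota; lia.
by exists `|h|%N; rewrite ?mem_iota; lia.
Qed.

Lemma window_uniq H : uniq (window H).
Proof.
rewrite cat_uniq !map_inj_uniq ?iota_uniq //=; try by move=> i j; lia.
rewrite andbT; apply/hasPn => h /mapP[i _ ->]; apply/mapP => -[j _]; lia.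
Qed.

Lemma sum_window (V : nmodType) (F : int -> V) H :
  \sum_(h <- window H) F h = \sum_(i < H) F (- i%:Z) + \sum_(i < H) F (i%:Z + 1).
Proof.
by rewrite big_cat !big_map -[X in iota 0 X]subn0 -/(index_iota 0 H) !big_mkord.
Qed.

Lemma rot_nth_true p u : (p < size u)%N -> nth false u p ->
  rot p u = true :: (drop p.+1 u ++ take p u).
Proof. by move=> lt_pu up; rewrite /rot (drop_nth false lt_pu) up. Qed.

Lemma sum_strip m H d w i j :
    (0 < m)%N -> (d <= H)%N -> (i < d)%N -> (j < d)%N ->
    delta w = -1 -> count_mem true w = m ->
  \sum_(s \in [set: int]%classic)
     (x0 ^+ left_count m.+1 w s * y0 ^+ right_count m.+1 w s) j i =
  \sum_(h <- window H) \sum_(p < size w | nth false w p)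
     weight (omega x0 y0) h (rot p w) j i.
Proof.
move=> m_gt0 le_dH lt_id lt_jd dw wm.
(* The value of s for which the period starts at the letter a of row [r] and at level [h]; the [k]
   of [strip_weight] is [height w r - h]. *)
pose row_label (r : nat) (h : int) := m%:Z * (height w r - h) + r%:Z - 1.
rewrite (fsbigE [seq row_label r h | r <- iota 0 m, h <- window H]) //; first last.
- move=> s _ s_notin.
  (* Division of [s + 1] by [m] recovers the row and the shift. *)
  pose r := `|((s + 1) %% m%:Z)%Z|%N; pose k := ((s + 1) %/ m%:Z)%Z.
  have lt_rm : (r < m)%N by rewrite /r; lia.
  have sE : s = m%:Z * k + r%:Z - 1 by rewrite /r /k; lia.
  rewrite sE strip_weight //.
  have lt_p : (nth 0%N (positions_a w) r < size w)%N by rewrite nth_positions_a_lt ?wm.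
  have wp : nth false w (nth 0%N (positions_a w) r).
    have := mem_nth 0%N (_ : r < size (positions_a w))%N.
    by rewrite size_positions_a wm lt_rm mem_filter => /(_ isT)/andP[/eqP].
  (* Outside the window the initial a alone already exceeds the bidegree. *)
  rewrite rot_nth_true // weight_cons (@small_omega d) //.
  have : height w r - k \notin window H.
    apply: contra s_notin => h_in; apply/allpairsPdep; exists r, (height w r - k).
    by rewrite mem_iota h_in lt_rm /row_label; split=> //; rewrite sE; lia.
  by rewrite mem_window; lia.
- apply: allpairs_uniq; rewrite ?iota_uniq ?window_uniq //.
  move=> [r h] [r' h'] /allpairsPdep[r1 [h1 [r1_in _ [-> ->]]]].
  move=> /allpairsPdep[r2 [h2 [r2_in _ [-> ->]]]] /=.
  move: r1_in r2_in; rewrite !mem_iota /= !add0n => lt_r1 lt_r2; rewrite /row_label => E.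
  have rE : r1 = r2.
    have : (r1%:Z = r2%:Z %[mod m%:Z])%Z.
      have -> : r1%:Z = r2%:Z + (height w r2 - h2 - (height w r1 - h1)) * m%:Z.
        by rewrite mulrBl; lia.
      by rewrite addrC modzMDl.
    by rewrite !modz_nat !modn_small //; lia.
  by subst r2; congr (_, _); nia.
rewrite (eq_bigl xpredT) => [|s]; last by apply/mem_set.
rewrite big_allpairs_dep exchange_big; apply: eq_bigr => h _.
rewrite -[X in iota 0 X]subn0 -/(index_iota 0 m) big_mkord.
rewrite -(big_occurrences _ (fun p => weight (omega x0 y0) h (rot p w) j i)) wm.
apply: eq_bigr => r _; rewrite /row_label strip_weight //.
by rewrite subKr.
Qed.

Lemma sum_weight_head (M : nat) h :
  \sum_(u : M.+1.-tuple bool | delta u == -1)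
    (if head false u then weight (omega x0 y0) h u else 0) =
  cyclic_paths x0 y0 M h.
Proof.
rewrite (sum_tuple_cons M (fun u => delta u == -1)
  (fun u => if head false u then weight (omega x0 y0) h u else 0)) /=.
rewrite [X in _ + X]big1 // addr0 /cyclic_paths -sum_weight_paths big_distrr.
apply: eq_big => t; last by rewrite weight_cons.
by rewrite delta_cons /step; lia.
Qed.

(** By [sum_strip], the sum runs over the words of D_n and their rotations that start with a. By the
    cycle lemma these are the words with [delta] equal to -1 that start with a, each once. *)
Lemma L_window m H d i j :
    (0 < m)%N -> (d <= H)%N -> (i < d)%N -> (j < d)%N ->
  L m.+1 j i = (\sum_(h <- window H) cyclic_paths x0 y0 (m + m) h) j i.
Proof.
move=> m_gt0 le_dH lt_id lt_jd.
rewrite /L eqSS (gtn_eqF m_gt0) !coefs_sum.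
have DsetE (w : (m.+1.-1 + m.+1).-tuple bool) :
    (w \in Dset m.+1) = (delta w == -1) && strict_nonneg w.
  rewrite inE andbA; congr (_ && _).
  by have := size_tuple w; rewrite size_count_ab /delta; lia.
rewrite (eq_bigl _ _ DsetE).
transitivity (\sum_(w : (m.+1.-1 + m.+1).-tuple bool | (delta w == -1) && strict_nonneg w)
    \sum_(h <- window H) \sum_(p < m.+1.-1 + m.+1 | nth false w p)
      weight (omega x0 y0) h (rot p w) j i).
  apply: eq_bigr => w; rewrite -DsetE => w_in.
  move: (w_in); rewrite inE => /and3P[/eqP wa _ _].
  move: w_in; rewrite DsetE => /andP[/eqP dw _].
  by have := sum_strip m_gt0 le_dH lt_id lt_jd dw wa; rewrite size_tuple.
rewrite exchange_big; apply: eq_bigr => h _.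
pose f u := if head false u then weight (omega x0 y0) h u else 0.
have -> : cyclic_paths x0 y0 (m + m) h =
    \sum_(w : (m + m.+1).-tuple bool | (delta w == -1) && strict_nonneg w)
      \sum_(p < m + m.+1) f (rot p w).
  by rewrite -sum_weight_head -addnS; exact: (sum_rotations (m + m.+1) f).
rewrite [RHS](_ : _ = \sum_(w : (m + m.+1).-tuple bool | (delta w == -1) && strict_nonneg w)
      \sum_(p < m + m.+1) f (rot p w) j i); last first.
  by rewrite !coefs_sum; apply: eq_bigr => w _; rewrite !coefs_sum.
apply: eq_bigr => w _; rewrite big_mkcond; apply: eq_bigr => p _.
have -> : f (rot p w) = if nth false w p then weight (omega x0 y0) h (rot p w) else 0.
  by rewrite /f /rot (drop_nth false) // size_tuple.
by case: nth.
Qed.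

Lemma L_formula m :
  (1 - x0) * (1 - y0) * L m.+1 =
  (1 - x0 * y0) * (closed_paths x0 y0 (m + m) 1 - cyclic_paths x0 y0 (m + m) 1).
Proof.
have [-> | m_gt0] := posnP m.
  (* The empty closed path weighs 1 and E_a(1) is 0, so the convention for L_1 is the case m = 0 of
     the formula. *)
  rewrite /L /closed_paths /cyclic_paths /= mulr0 subr0 -/x0 -/y0.
  have ux : 1 - x0 \is a GRing.unit by rewrite !fps_unit_1B subr0 unitr1.
  have uy : 1 - y0 \is a GRing.unit by rewrite fps_unit_1B subr0 unitr1.
  by rewrite mulr1 geometric_sum.
apply/eqP; rewrite -subr_eq0; apply/eqP/small_eq0 => d.
(* The successor keeps [1 - H] at distance [m + m + d] from 0, as [small_closed_paths] requires. *)
pose H := (m + m + d).+1; pose S := \sum_(h <- window H) cyclic_paths x0 y0 (m + m) h.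
have := sum_cyclic_paths x0 y0 (m + m) H; rewrite -sum_window -/S.
set U := closed_paths x0 y0 _ 1 - _; set e1 := _ - closed_paths x0 y0 _ (H%:Z + 1).
set e2 := _ - closed_paths x0 y0 _ (1 - H%:Z) => SE.
have -> : (1 - x0) * (1 - y0) * L m.+1 - (1 - x0 * y0) * U =
    (1 - x0) * (1 - y0) * (L m.+1 - S) + (1 - x0) * y0 * e1 + (1 - y0) * e2.
  by rewrite (mulrBr _ (L _)) SE; ring.
have mm_gt0 : (0 < m + m)%N by lia.
apply: smallD; first apply: smallD.
- apply: smallM => i j lt_id lt_jd.
  by rewrite !coefsB (@L_window m H d) ?subrr //; rewrite /H; lia.
- apply/smallM/smallD; first by apply: small_omega; rewrite /H; lia.
  by apply/smallN/small_closed_paths => //; rewrite /H; lia.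
- apply/smallM/smallD; first by apply: small_omega; rewrite /H; lia.
  by apply/smallN/small_closed_paths => //; rewrite /H; lia.
Qed.

Lemma path_series_coefs m :
  (path_series x0 y0 1 1 - (path_series x0 y0 0 1 - path_series x0 y0 0 0)) m =
  closed_paths x0 y0 (m + m) 1 - cyclic_paths x0 y0 (m + m) 1.
Proof.
rewrite !coefsB /closed_paths /cyclic_paths.
have -> : path_series x0 y0 1 1 m = pathsZ x0 y0 (m + m)%N%:Z 1 1.
  by congr (pathsZ _ _ _ _ _); lia.
have -> : path_series x0 y0 0 1 m = pathsZ x0 y0 (m + m).+1%:Z 1 0.
  by congr (pathsZ _ _ _ _ _); lia.
have -> : path_series x0 y0 0 0 m = pathsZ x0 y0 (m + m)%N%:Z 0 0.
  by congr (pathsZ _ _ _ _ _); lia.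
by rewrite /pathsZ [paths _ _ (_.+1) _ _]/= subrr addrK.
Qed.

End Lseries.

Theorem theorem6 :
  let x0 : fps (fps int) := fpsC fpsX in
  let y0 : fps (fps int) := fpsX in
  let x : fps (fps (fps int)) := fpsC x0 in
  let y : fps (fps (fps int)) := fpsC y0 in
  let z : fps (fps (fps int)) := fpsX in
  LL = (1 - x * y) / ((1 - x) * (1 - y)) *
       ((C x0 (x * z) + C y0 (y * z) - C x0 (x * z) * C y0 (y * z)) /
        (1 - z * C x0 (x * z) * C y0 (y * z))).
Proof.
move=> x0 y0 x y z; rewrite !C_excursion_series -path_series_total.
set T := path_series _ _ _ _ - _; set K := 1 - z * _ * _.
have uK : K \is a GRing.unit.
  by rewrite fps_unit_1B -mulrA coefsXM subr0 unitr1.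
have uV : (1 - x) * (1 - y) \is a GRing.unit.
  rewrite unitrM (fps_unit_1B x) (fps_unit_1B y) (fps_unit_1B x0) (fps_unit_1B y0).
  by rewrite (fps_unit_1B fpsX) !subr0 !unitr1.
(* The numerator is a multiple of [K], which cancels; clearing the other denominator leaves an
   identity to be checked on the coefficients in z. *)
rewrite mulrK // mulrAC; apply: (mulIr uV); rewrite divrK // mulrC.
have -> : (1 - x) * (1 - y) = fpsC ((1 - x0) * (1 - y0)).
  by rewrite fpsCM !fpsCB fpsC1.
have -> : 1 - x * y = fpsC (1 - x0 * y0) by rewrite fpsCB fpsC1 fpsCM.
apply: fpsP => m; rewrite !coefsCM path_series_coefs; exact: L_formula.
Qed.
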